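(* Let $\boldsymbol{\pi}\in\mathbb{R}^n$ be a vector with positive entries such that $\boldsymbol{\pi}^T\mathbf{1}=1$. The map $R: \mathcal{T}\mathbb{S}_n^{\boldsymbol{\pi}} \to \mathbb{S}_n^{\boldsymbol{\pi}}$ whose restriction $R_{S}$ to $\mathcal{T}_S\mathbb{S}_n^{\boldsymbol{\pi}}$ is given by $$R_{S}(\xi_S) = S + \xi_S$$ is a well-defined retraction on $\mathbb{S}_n^{\boldsymbol{\pi}}$ whenever $\xi_S$ is in a neighborhood of $\mathbf{0}_{S}$, i.e., whenever $S > - \xi_S$ entrywise.
   Context: $\mathbf{1}=(1,\ldots,1)^T\in\mathbb{R}^n$; inequalities between matrices are entrywise. $\mathbb{S}_n^{\boldsymbol{\pi}} = \{ S \in \mathbb{R}^{n \times n} : S \mathbf{1} = \mathbf{1},\ \boldsymbol{\pi}^T S = \boldsymbol{\pi}^T,\ S > 0 \}$ is an embedded submanifold of $\mathbb{R}^{n\times n}$ whose tangent space at $S$ is $\mathcal{T}_S \mathbb{S}_n^{\boldsymbol{\pi}} = \{ \xi \in \mathbb{R}^{n \times n} : \xi \mathbf{1} = \mathbf{0},\ \boldsymbol{\pi}^T \xi = \mathbf{0}^T \}$, $\mathbf{0}_S$ is its zero vector, and $\mathcal{T}\mathbb{S}_n^{\boldsymbol{\pi}}$ is the tangent bundle (disjoint union of the tangent spaces). A retraction on a manifold $\mathcal{M}$ is a smooth map $R$ from the tangent bundle $\mathcal{T}\mathcal{M}$ to $\mathcal{M}$ such that, for every $x\in\mathcal{M}$,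 the restriction $R_x$ of $R$ to $\mathcal{T}_x\mathcal{M}$ satisfies: (centering) $R_x(0)=x$; (local rigidity) for every $\xi_x\in\mathcal{T}_x\mathcal{M}$, the curve $\gamma_{\xi_x}(\tau)=R_x(\tau\xi_x)$ satisfies $\frac{d\gamma_{\xi_x}(\tau)}{d\tau}\big|_{\tau=0}=\xi_x$. Here the retraction is only required to be defined on the set of $(S,\xi_S)$, with $S\in\mathbb{S}_n^{\boldsymbol{\pi}}$ and $\xi_S\in\mathcal{T}_S\mathbb{S}_n^{\boldsymbol{\pi}}$, such that $S>-\xi_S$ (i.e. $S+\xi_S>0$). *)

(* Defs.v *)
From HB Require Import structures.
From mathcomp Require Import all_boot all_order all_algebra.
From mathcomp Require Import all_classical all_reals all_analysis.

Set Implicit Arguments.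
Unset Strict Implicit.
Unset Printing Implicit Defensive.

Import Order.TTheory GRing.Theory Num.Theory.
Import numFieldNormedType.Exports.

Local Open Scope classical_set_scope.
Local Open Scope ring_scope.

Section Smoothness.
Context {R : realType}.

(* For finite-dimensional V and open U this is the usual C^k(U): all partial
   derivatives up to order k exist and are continuous on U. *)
Fixpoint Ck_on {V W : normedModType R} (k : nat) (U : set V) (f : V -> W) : Prop :=
  if k is k'.+1 then
    (forall x, U x -> differentiable f x) /\
    (forall v : V, Ck_on k' U (fun x => 'D_v f x))
  else forall x, U x -> {for x, continuous f}.

(* Smoothness of a map that is only considered on a subset D of the ambient
   space: local existence of a smooth extension to an open set. For D open in
   an embedded submanifold, this is smoothness in the manifold sense. *)
Definition smooth_on_subset {V W : normedModType R} (D : set V) (f : V -> W) :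
    Prop :=
  forall x, D x -> exists (U : set V) (g : V -> W),
    [/\ open U, U x, (forall k, Ck_on k U g)
      & forall y, U y -> D y -> f y = g y].

End Smoothness.

Section Retraction.
Context {R : realType} {E : normedModType R}.

Definition tangent_bundle (M : set E) (T : E -> set E) : set (E * E) :=
  [set p | M p.1 /\ T p.1 p.2].

(* M is an embedded submanifold of E with tangent space T x at x in M. The
   values of F outside of the domain D are irrelevant: since D is open in the
   tangent bundle and contains the zero section, the curve t |-> (x, t *: v)
   lies in D for t near 0. *)
Record retraction_on (M : set E) (T : E -> set E) (D : set (E * E))
    (F : E * E -> E) : Prop := {
  retr_dom_sub : D `<=` tangent_bundle M T;
  retr_dom_open : exists2 U : set (E * E),
    open U & D = U `&` tangent_bundle M T;
  retr_dom_zero : forall x, M x -> D (x, 0);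
  retr_codom : forall p, D p -> M (F p);
  retr_smooth : smooth_on_subset D F;
  retr_centering : forall x, M x -> F (x, 0) = x;
  retr_rigidity : forall x v, M x -> T x v ->
    is_derive (0 : R) (1 : R) (fun t : R => F (x, t *: v)) v
}.

End Retraction.

Section Multinomial.
Context {R : realType} {n : nat}.
Implicit Types (pi : 'cV[R]_n) (S xi : 'M[R]_n).

Definition ones : 'cV[R]_n := const_mx 1.

Definition gt_mx (A B : 'M[R]_n) : Prop := forall i j, B i j < A i j.

Definition multinomial pi : set 'M[R]_n :=
  [set S | [/\ S *m ones = ones, pi^T *m S = pi^T & gt_mx S 0]].

Definition multinomial_tangent pi S : set 'M[R]_n :=
  [set xi | xi *m ones = 0 /\ pi^T *m xi = 0].

(* The multinomial set is relatively open in an affine subspace with direction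
   multinomial_tangent pi S; hence it is an embedded submanifold of 'M[R]_n,
   with that tangent space at S. *)
Lemma open_gt_mx0 : open [set S : 'M[R]_n | gt_mx S 0].
Proof.
rewrite openE => S S0.
change (\forall X \near S, forall i j, (0 : 'M[R]_n) i j < (X : 'M[R]_n) i j).
apply: (@filter_forall _ 'I_n _ _ (nbhs_filter S)) => i.
apply: (@filter_forall _ 'I_n _ _ (nbhs_filter S)) => j.
have Sij : 0 < S i j by have := S0 i j; rewrite mxE.
have Spos : nbhs (S i j) [set x | 0 < x] by exact: lt_nbhsr.
have := @coord_continuous R n n i j S _ Spos.
by apply: (@filterS _ _ (nbhs_filter S)) => X /=; rewrite mxE.
Qed.

Lemma multinomial_affine pi S S' : multinomial pi S ->
  multinomial pi S' <-> multinomial_tangent pi S (S' - S) /\ gt_mx S' 0.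
Proof.
move=> [S1 piS _]; rewrite /multinomial /multinomial_tangent /=.
rewrite mulmxBl mulmxBr S1 piS; split.
  by move=> [-> -> ?]; rewrite !subrr.
by move=> [[/subr0_eq -> /subr0_eq ->] ?].
Qed.

Definition multinomial_retr_dom pi : set ('M[R]_n * 'M[R]_n) :=
  [set p | tangent_bundle (multinomial pi) (multinomial_tangent pi) p /\
           gt_mx p.1 (- p.2)].

End Multinomial.

(* Main.v *)
Require Import Defs.
From mathcomp Require Import all_boot all_order all_algebra.
From mathcomp Require Import all_classical all_reals all_analysis.
Import numFieldNormedType.Exports.
Local Open Scope ring_scope.
Import GRing.Theory Num.Theory.

(** The multinomial manifold is cut out of an affine subspace by the open
    condition [S > 0], and its tangent spaces all equal the direction of that
    subspace; so [S + xi] stays on the manifold exactly when its entries are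
    positive, which is the condition [S > - xi] ([gt_mx_opp]). The retraction
    is the restriction of addition, a continuous linear map on the product of
    the ambient space with itself. Its continuity makes the domain relatively
    open in the tangent bundle, as the preimage of the open set of positive
    matrices. Its linearity makes it smooth on the whole ambient space
    ([Ck_on_linear]): the derivative of a linear map in a fixed direction is a
    constant function. Rigidity holds because [t |-> S + t *: xi] is a line
    with velocity [xi] ([is_derive_line]). *)

Lemma Ck_on_cst (R : realType) (V W : normedModType R) (k : nat) (U : set V)
    (w : W) : Ck_on k U (cst w).
Proof.
elim: k w => [|k IH] w /=; first by move=> x _; exact: cst_continuous.
split=> [x _|v]; first exact: differentiable_cst.
have -> : (fun x => 'D_v (cst w) x) = cst 0.
  by apply/funext => x; exact: derive_cst.
exact: IH.
Qed.

Lemma Ck_on_linear (R : realType) (V W : normedModType R) (k : nat) (U : set V)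
    (f : {linear V -> W}) : continuous f -> Ck_on k U f.
Proof.
move=> cf; case: k => [|k] /=; first by move=> x _; exact: cf.
split=> [x _|v]; first exact: linear_differentiable.
suff -> : (fun x => 'D_v f x) = cst (f v) by exact: Ck_on_cst.
apply/funext => x.
by rewrite deriveE ?diff_lin //; exact: linear_differentiable.
Qed.

Lemma add_pair_continuous (R : realType) (V : normedModType R) :
  continuous ((fst : V * V -> V) \+ snd).
Proof. by move=> p; apply: cvgD; [exact: cvg_fst|exact: cvg_snd]. Qed.

Lemma is_derive_line (R : realType) (V : normedModType R) (x v : V) :
  is_derive (0 : R) (1 : R) (fun t : R => x + t *: v) v.
Proof.
have dfl : is_diff (0 : R) ( *:%R ^~ v) ( *:%R ^~ v) by exact: is_diff_scalel.
have drv : is_derive (0 : R) (1 : R) ( *:%R ^~ v) v.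
  apply: DeriveDef; first exact: diff_derivable.
  by rewrite deriveE // diff_val scale1r.
by rewrite -[X in is_derive _ _ _ X]add0r; apply: is_deriveD.
Qed.

Lemma gt_mx_opp (R : realType) (n : nat) (A B : 'M[R]_n) :
  gt_mx A (- B) <-> gt_mx (A + B) 0.
Proof.
have entry i j : ((- B) i j < A i j) = ((0 : 'M[R]_n) i j < (A + B) i j).
  by rewrite !mxE -subr_gt0 opprK.
by split=> H i j; [rewrite -entry|rewrite entry]; exact: H.
Qed.

Theorem theorem4p9 (R : realType) (n : nat) (pi : 'cV[R]_n)
    (pi_gt0 : forall i, 0 < pi i ord0)
    (pi_sum1 : pi^T *m ones = 1%:M) :
  retraction_on (multinomial pi) (multinomial_tangent pi)
    (multinomial_retr_dom pi)
    (fun p : 'M[R]_n * 'M[R]_n => p.1 + p.2).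
Proof.
split.
- by move=> p [].
- exists ((fst \+ snd) @^-1` [set A : 'M[R]_n | gt_mx A 0])%classic.
    apply: open_comp; last exact: open_gt_mx0.
    by move=> p _; exact: add_pair_continuous.
  by apply/seteqP; split=> p /= [H1 H2]; split=> //; apply/gt_mx_opp.
- move=> S [S1 piS S_gt0]; split; last by apply/gt_mx_opp; rewrite /= addr0.
  by split=> //; rewrite /= /multinomial_tangent /= mul0mx mulmx0.
- move=> p [[[S1 piS _] [xi1 pixi]] /gt_mx_opp gt0]; split=> //.
    by rewrite mulmxDl S1 xi1 addr0.
  by rewrite mulmxDr piS pixi addr0.
- move=> p _; exists setT, (fst \+ snd); split=> //; first exact: openT.
  by move=> k; apply: Ck_on_linear; exact: add_pair_continuous.
- by move=> S _; rewrite /= addr0.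
- by move=> S xi _ _; exact: is_derive_line.
Qed.
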